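(* Let $a,u$ be coprime positive integers with $a\neq u$, and let $\Delta=u^{2}-a^{2}\neq 0$. If $P_{a,u}(t)$ factors in $\mathbb{Z}[t]$ as a product of two monic quartic polynomials, then there exists $X\in\mathbb{Z}$ such that $$(X^{2}-8\Delta^{2})(X^{2}-9\Delta^{2})=4\,a^{2}u^{2}\,X^{2}.$$
   Context: For positive integers $a,u$, with $\Delta=u^{2}-a^{2}$, define the even monic polynomial $$P_{a,u}(t)=t^{8}+6\Delta\,t^{6}+(\Delta^{2}-2a^{2}u^{2})\,t^{4}-6\Delta\,a^{2}u^{2}\,t^{2}+a^{4}u^{4}\in\mathbb{Z}[t].$$ *)

(* Defs.v *)
From mathcomp Require Import all_boot all_order all_algebra.

Set Implicit Arguments.
Unset Strict Implicit.
Unset Printing Implicit Defensive.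

Import Order.TTheory GRing.Theory Num.Theory.
Local Open Scope ring_scope.

Definition Delta (a u : int) : int := u ^+ 2 - a ^+ 2.

Definition Pau (a u : int) : {poly int} :=
  'X^8 + (6 * Delta a u) *: 'X^6
       + (Delta a u ^+ 2 - 2 * a ^+ 2 * u ^+ 2) *: 'X^4
       - (6 * Delta a u * a ^+ 2 * u ^+ 2) *: 'X^2
       + (a ^+ 4 * u ^+ 4)%:P.

(* Main.v *)
Require Import Defs.
From mathcomp Require Import all_boot all_order all_algebra.
From mathcomp Require Import ring lra zify.

Import Order.TTheory GRing.Theory Num.Theory.
Local Open Scope ring_scope.

(** Write [m = a * u], [D = Delta a u] and [s = t ^ 2].  Then [Pau a u] is the
    quartic [Q(s) = s^4 + 6 D s^3 + (D^2 - 2 m^2) s^2 - 6 D m^2 s + m^4], and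
    [Q(s) = (s^2 - m^2 + 3 D s)^2 - 8 D^2 s^2], because [Q] is invariant under
    [s -> - m^2 / s].  Hence [Q] splits over Q(sqrt 2) into two quadratics with
    constant term [- m^2], and the irrationality of [sqrt 2] does most of the
    work.

    Split the factors into even and odd parts, [p = E(s) + t O(s)] and
    [q = F(s) + t G(s)], so that [E G + O F = 0] and [E F + s O G = Q].
    The coefficients of [s] in [O] and [G] are opposite, which leaves
    three possibilities.
    - [O] vanishes at a rational [r] where [G] does not.  Then [E(r) = 0] as
      well, so [Q(r) = 0], and [sqrt 2] would be rational
      ([quartic_no_rational_root]).
    - [O] is nonzero and proportional to [G].  Then [G = - O] and [E = F], that
      is, [q(t) = p(-t)].  The common constant term of [p] and [q] is [m^2] or
      [- m^2], and each sign makes a positive sum of squares vanish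
      ([conjugate_factors_absurd]).
    - [O = G = 0], so [Q = (s^2 + b s + c) (s^2 + d s + e)].  The case
      [c = - m^2] is the splitting over Q(sqrt 2) and is not rational;
      otherwise the involution [s -> - m^2 / s] exchanges the two factors, and
      this says that [X = b - 3 D = (b - d) / 2] solves the required equation
      ([even_factors_solution]). *)

(** The 2-adic valuation of [8 * y ^ 2] is odd. *)
Lemma sqr_eq_8sqr (x y : int) : x ^+ 2 = 8 * y ^+ 2 -> y = 0.
Proof.
move=> /(congr1 absz); rewrite abszM !abszX => e.
apply/eqP; rewrite -absz_eq0; apply: contraT; rewrite -lt0n => y0.
have x0 : (0 < `|x|)%N by nia.
have := congr1 (logn 2) e.
rewrite lognM ?expn_gt0 ?y0 // !lognX (_ : logn 2 `|8 : int| = 3%N) //.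
lia.
Qed.

(** A rational root [z / x] satisfies
    [(z^2 - m^2 x^2 + 3 D z x)^2 = 8 (D z x)^2]; the lemma is homogenised in
    order to stay over the integers. *)
Lemma quartic_no_rational_root (m D x z : int) :
    m != 0 -> D != 0 -> x != 0 ->
  z ^+ 4 + 6 * D * z ^+ 3 * x + (D ^+ 2 - 2 * m ^+ 2) * z ^+ 2 * x ^+ 2
    - 6 * D * m ^+ 2 * z * x ^+ 3 + m ^+ 4 * x ^+ 4 <> 0.
Proof.
move=> m0 D0 x0 root.
have e : (z ^+ 2 - m ^+ 2 * x ^+ 2 + 3 * D * z * x) ^+ 2
    = 8 * (D * z * x) ^+ 2.
  by apply/eqP; rewrite -subr_eq0 -root; apply/eqP; ring.
have /eqP := sqr_eq_8sqr _ _ e.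
rewrite !mulf_eq0 (negPf D0) (negPf x0) orbF /= => /eqP z0.
move: root; rewrite z0 => root.
have /eqP : m ^+ 4 * x ^+ 4 = 0 by rewrite -root; ring.
by rewrite mulf_eq0 !expf_eq0 (negPf m0) (negPf x0).
Qed.

(** The hypotheses are the coefficients of [p(t) p(-t)], for
    [p = t^4 + x t^3 + y t^2 + z t + w]. *)
Lemma conjugate_factors_absurd (m D x y z w : int) :
    m != 0 -> D != 0 -> (x != 0) || (z != 0) ->
    2 * y - x ^+ 2 = 6 * D ->
    y ^+ 2 + 2 * w - 2 * x * z = D ^+ 2 - 2 * m ^+ 2 ->
    2 * y * w - z ^+ 2 = - (6 * D * m ^+ 2) ->
    w ^+ 2 = m ^+ 4 ->
  False.
Proof.
move=> m0 D0 xz e6 e4 e2 e0.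
have m2 : 0 < m ^+ 2 by rewrite exprn_even_gt0.
have D2 : 0 < D ^+ 2 by rewrite exprn_even_gt0.
have /eqP : (w - m ^+ 2) * (w + m ^+ 2) = 0.
  by rewrite -subr_sqr e0 -exprM subrr.
rewrite mulf_eq0 subr_eq0 addr_eq0 => /orP[] /eqP wE; subst w.
- have mx : 0 < m ^+ 2 * D ^+ 2 by rewrite mulr_gt0.
  have z2 : z ^+ 2 = m ^+ 2 * (x ^+ 2 + 12 * D).
    have -> : z ^+ 2 = 2 * y * m ^+ 2 + 6 * D * m ^+ 2 by lra.
    by rewrite (_ : 2 * y = x ^+ 2 + 6 * D); [ring | lra].
  have xzE : 8 * (x * z) = (x ^+ 2 + 6 * D) ^+ 2 - 4 * D ^+ 2 + 16 * m ^+ 2.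
    by rewrite (_ : x ^+ 2 + 6 * D = 2 * y); [lra | lra].
  have neg : (x * z - 4 * m ^+ 2) ^+ 2 = - (32 * (m ^+ 2 * D ^+ 2)).
    transitivity (x ^+ 2 * z ^+ 2 - m ^+ 2 * (8 * (x * z)) + 16 * m ^+ 4).
      by ring.
    by rewrite xzE z2; ring.
  have := sqr_ge0 (x * z - 4 * m ^+ 2); rewrite neg; lra.
- have sum0 : z ^+ 2 + m ^+ 2 * x ^+ 2 = 0.
    have -> : x ^+ 2 = 2 * y - 6 * D by lra.
    lra.
  case/orP: xz => n0.
  + have : 0 < m ^+ 2 * x ^+ 2 by rewrite mulr_gt0 // exprn_even_gt0.
    have := sqr_ge0 z; lra.
  + have : 0 < z ^+ 2 by rewrite exprn_even_gt0.
    have : 0 <= m ^+ 2 * x ^+ 2 by rewrite mulr_ge0 ?sqr_ge0.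
    lra.
Qed.

(** Here [Q = (s^2 + b s + c) (s^2 + d s + e)].  The substitution
    [s -> - m^2 / s] carries the first factor to the second, up to a scalar,
    exactly when [c d = - b m^2] and [b e = - d m^2].  Away from [c = - m^2]
    these two equations follow from the values of [c e] and [b e + c d]. *)
Lemma even_factors_solution (m D b c d e : int) :
    m != 0 -> D != 0 ->
    b + d = 6 * D ->
    c + e + b * d = D ^+ 2 - 2 * m ^+ 2 ->
    b * e + c * d = - (6 * D * m ^+ 2) ->
    c * e = m ^+ 4 ->
  let X := b - 3 * D in
  (X ^+ 2 - 8 * D ^+ 2) * (X ^+ 2 - 9 * D ^+ 2) = 4 * m ^+ 2 * X ^+ 2.
Proof.
move=> m0 D0 e6 e4 e2 e0 X.
have m20 : m ^+ 2 != 0 by rewrite expf_neq0.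
have c0 : c != 0.
  apply: contraTneq (expf_neq0 4 m0) => c0.
  by rewrite -e0 c0 mul0r eqxx.
have [cE|cN] := eqVneq (c + m ^+ 2) 0.
  have {}cE : c = - m ^+ 2 by lra.
  have eE : e = - m ^+ 2.
    apply: (mulfI c0); rewrite e0 cE; ring.
  have bd : b * d = D ^+ 2 by rewrite cE eE in e4; lra.
  have : (b - d) ^+ 2 = 8 * (2 * D) ^+ 2.
    transitivity ((b + d) ^+ 2 - 4 * (b * d)); first by ring.
    by rewrite e6 bd; ring.
  by move/sqr_eq_8sqr; move: D0 => /eqP; lia.
have cd : c * d = - (b * m ^+ 2).
  apply: (mulIf cN); apply/eqP; rewrite -subr_eq0; apply/eqP.
  transitivity (c * ((b * e + c * d) + m ^+ 2 * (b + d))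
    - b * (c * e - m ^+ 4)); first by ring.
  by rewrite e2 e6 e0; ring.
have be : b * e = - (d * m ^+ 2).
  have -> : b * e = - (6 * D) * m ^+ 2 - c * d by lra.
  by rewrite cd -e6; ring.
have X8 : X ^+ 2 - 8 * D ^+ 2 = c + e + 2 * m ^+ 2.
  transitivity (D ^+ 2 - b * d); last by lra.
  have -> : d = 6 * D - b by lra.
  by rewrite /X; ring.
have X9 : X ^+ 2 - 9 * D ^+ 2 = - (b * d).
  have -> : d = 6 * D - b by lra.
  by rewrite /X; ring.
have X2 : 4 * X ^+ 2 = (b - d) ^+ 2.
  have -> : d = 6 * D - b by lra.
  by rewrite /X; ring.
rewrite X8 X9.
transitivity (m ^+ 2 * (4 * X ^+ 2)); last by ring.
rewrite X2.
transitivity (- b * (c * d) - d * (b * e) - 2 * m ^+ 2 * b * d); first by ring.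
by rewrite cd be; ring.
Qed.

Lemma coefM_quartic_monic (R : comNzRingType) (p q : {poly R}) :
    p \is monic -> q \is monic -> size p = 5%N -> size q = 5%N ->
  [/\ (p * q)`_0 = p`_0 * q`_0,
      (p * q)`_1 = p`_0 * q`_1 + p`_1 * q`_0,
      (p * q)`_2 = p`_0 * q`_2 + p`_1 * q`_1 + p`_2 * q`_0 &
      (p * q)`_3 = p`_0 * q`_3 + p`_1 * q`_2 + p`_2 * q`_1 + p`_3 * q`_0] /\
  [/\ (p * q)`_4 = p`_0 + p`_1 * q`_3 + p`_2 * q`_2 + p`_3 * q`_1 + q`_0,
      (p * q)`_5 = p`_1 + p`_2 * q`_3 + p`_3 * q`_2 + q`_1,
      (p * q)`_6 = p`_2 + p`_3 * q`_3 + q`_2 &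
      (p * q)`_7 = p`_3 + q`_3].
Proof.
move=> /monicP + /monicP + sp sq; rewrite !lead_coefE sp sq /= => p4 q4.
have pz i : (4 < i)%N -> p`_i = 0 by move=> ?; rewrite nth_default ?sp.
have qz i : (4 < i)%N -> q`_i = 0 by move=> ?; rewrite nth_default ?sq.
by split; split; rewrite coefM !big_ord_recr big_ord0 /= ?subSS ?subn0
  ?p4 ?q4 ?(pz 5%N, pz 6%N, pz 7%N) // ?(qz 5%N, qz 6%N, qz 7%N) //; ring.
Qed.

Theorem theorem3 (a u : int) (ha : 0 < a) (hu : 0 < u)
    (hco : coprimez a u) (hne : a != u)
    (hfact : exists p q : {poly int},
        [/\ p \is monic, q \is monic, size p = 5%N, size q = 5%N
          & Pau a u = p * q]) :
  exists X : int,
    (X ^+ 2 - 8 * Delta a u ^+ 2) * (X ^+ 2 - 9 * Delta a u ^+ 2)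
      = 4 * a ^+ 2 * u ^+ 2 * X ^+ 2.
Proof.
case: hfact => p [q [mp mq sp sq PE]].
have m0 : a * u != 0 by rewrite mulf_neq0 ?gt_eqF.
have D0 : Delta a u != 0.
  by rewrite /Delta subr_eq0 eqrXn2 ?ltW // eq_sym.
have := coefM_quartic_monic _ _ _ mp mq sp sq.
rewrite -PE /Pau !coefE /= !(mulr0, mulr1, addr0, add0r, subr0, oppr0, sub0r).
set D := Delta a u in D0 *; set m := a * u in m0 *.
rewrite (_ : a ^+ 4 * u ^+ 4 = m ^+ 4); last by rewrite /m; ring.
rewrite (_ : 6 * D * a ^+ 2 * u ^+ 2 = 6 * D * m ^+ 2); last by rewrite /m; ring.
rewrite (_ : 2 * a ^+ 2 * u ^+ 2 = 2 * m ^+ 2); last by rewrite /m; ring.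
rewrite (_ : 4 * a ^+ 2 * u ^+ 2 = 4 * m ^+ 2); last by rewrite /m; ring.
move: p`_0 p`_1 p`_2 p`_3 q`_0 q`_1 q`_2 q`_3 => w z y x w' z' y' x'.
move=> [[e0 e1 e2 e3] [e4 e5 e6 e7]].
have {e7} xE : x' = - x by lra.
subst x'.
have [/andP[/eqP x0 /eqP z0]|] := boolP ((x == 0) && (z == 0)).
  subst x z; exists (y - 3 * D).
  have z'0 : z' = 0 by lra.
  subst z'.
  by apply: (even_factors_solution m D y w y' w') => //; lra.
rewrite negb_and => xz; exfalso.
have [zz|zz] := eqVneq (z + z') 0.
- have {zz} zE : z' = - z by lra.
  subst z'.
  have [yE wE] : y' = y /\ w' = w.
    have xy : x * (y' - y) = 0 by lra.
    have xzyw : x * (w' - w) + z * (y' - y) = 0 by lra.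
    have zw : z * (w' - w) = 0 by lra.
    have [x0|x0] := eqVneq x 0.
      have z0 : z != 0 by move: xz; rewrite x0 eqxx.
      rewrite x0 mul0r add0r in xzyw.
      by split; apply/eqP; rewrite -subr_eq0 -(mulrI_eq0 _ (mulfI z0));
        apply/eqP.
    have yE : y' = y.
      by apply/eqP; rewrite -subr_eq0 -(mulrI_eq0 _ (mulfI x0)); apply/eqP.
    split=> //; rewrite yE subrr mulr0 addr0 in xzyw.
    by apply/eqP; rewrite -subr_eq0 -(mulrI_eq0 _ (mulfI x0)); apply/eqP.
  subst y' w'.
  by apply: (@conjugate_factors_absurd m D x y z w) => //; lra.
- have x0 : x != 0.
    by apply: contra zz => /eqP x0; rewrite x0 in e5; apply/eqP; lra.
  (* The left-hand side is [x ^ 2 * E(r)], at the root [r = - z / x]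
     of [O = x s + z]. *)
  have E0 : z ^+ 2 - y * z * x + w * x ^+ 2 = 0.
    apply: (mulIf zz); rewrite mul0r.
    transitivity (z ^+ 2 * (z + y * - x + x * y' + z')
      - z * x * (w * - x + z * y' + y * z' + x * w')
      + x ^+ 2 * (w * z' + z * w')); first by ring.
    by rewrite -e5 -e3 -e1; ring.
  apply: (@quartic_no_rational_root m D x (- z) m0 D0 x0).
  transitivity ((z ^+ 2 - y * z * x + w * x ^+ 2)
    * (z ^+ 2 - y' * z * x + w' * x ^+ 2)); last by rewrite E0 mul0r.
  rewrite e0.
  transitivity (z ^+ 4 - (6 * D) * z ^+ 3 * x
    + (D ^+ 2 - 2 * m ^+ 2) * z ^+ 2 * x ^+ 2
    + - (6 * D * m ^+ 2) * - z * x ^+ 3 + w * w' * x ^+ 4).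
    by ring.
  by rewrite e2 e4 e6; ring.
Qed.
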